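(* Let $(g_2,\dots,g_n)$ be a tower and $C$ its cycle, started at $\mathbf 1$. For $0\le i<n!$ write $i=\sum_{k=2}^{n}c_k\,(k-1)!$ with $0\le c_k<k$, the factorial-base expansion. Then the vertex at position $i$ is $$\pi(i)=u_n^{c_n}u_{n-1}^{c_{n-1}}\cdots u_2^{c_2}.$$ The generator applied between positions $i$ and $i+1$ is $g_k$, where $k$ is the least level with $c_k<k-1$; equivalently, the largest $k$ with $(k-1)!\mid i+1$.
   Context: Let $n\ge 2$. Permutations in $S_n$ are multiplied as functions: $(\pi g)(i)=\pi(g(i))$; $\mathbf 1$ is the identity. For $1\le k\le n$, $G_k=\mathrm{Sym}\{1,\dots,k\}$ is the subgroup of $S_n$ of permutations fixing each of $k+1,\dots,n$. A $k$-cycle on $\{1,\dots,k\}$ is an element of $G_k$ that is a single cycle of length $k$. A tower is a sequence $(g_2,\dots,g_n)$ with $g_k\in G_k\setminus G_{k-1}$ such that, setting $g_1:=\mathbf 1$, each quotient $u_k:=g_{k-1}^{-1}g_k$ is a $k$-cycle on $\{1,\dots,k\}$ $(2\le k\le n)$. The levels are the indices $k=2,\dots,n$. Words over the alphabet $\{g_2,\dots,g_n\}$ are defined by $M_1=\varepsilon$ (the empty word) and $M_k=(M_{k-1}\,g_k)^{k-1}M_{k-1}$ for $2\le k\le n$. A word is read as a walk in the Cayley graph of $S_n$ with generators $g_2,\dots,g_n$, each letter being a right multiplication. The word $M_ng_n=w_1w_2\cdots w_{n!}$, read from $\mathbf 1$, traverses a Hamiltonian cycle, which is the cycle $C$ of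 the tower: the vertex at position $i$ is $\pi(i)=w_1w_2\cdots w_i$ (so $\pi(0)=\mathbf 1$), the generator applied between positions $i$ and $i+1$ is the letter $w_{i+1}$, and the last letter $w_{n!}=g_n$ returns the walk to $\mathbf 1$, so that position $n!$ is position $0$.
   Formalization: At the last position i = n!-1 all digits are c_k = k-1, so no least level with c_k < k-1 exists; the least-level description and the equivalence are stated for i+1 < n!, while the divisibility description, with k ranging over the levels 2,…,n, covers all 0 ≤ i < n!. *)

(* Defs.v *)
From mathcomp Require Import all_boot all_fingroup.

Set Implicit Arguments.
Unset Strict Implicit.
Unset Printing Implicit Defensive.

(* The points 1, ..., n are represented by the ordinals 0, ..., n - 1, so that
   {1, ..., k} is the set of ordinals smaller than k. *)

(* The product of permutations as functions, (p g)(i) = p (g i).  MathComp's own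
   product on 'S_n applies the left factor first, hence the swap; the identity,
   inverses and powers are the same for the two products. *)
Definition pcomp (n : nat) (p q : 'S_n) : 'S_n := (q * p)%g.

Lemma pcompE (n : nat) (p q : 'S_n) (i : 'I_n) : pcomp p q i = p (q i).
Proof. by rewrite /pcomp permM. Qed.

Definition symG (n k : nat) : {set 'S_n} := Sym [set i : 'I_n | i < k].

Definition single_cycle (n k : nat) (s : 'S_n) : bool :=
  [exists x, (#|porbit s x| == k) && perm_on (porbit s x) s].

Definition kcycle (n k : nat) (s : 'S_n) : bool :=
  (s \in symG n k) && single_cycle k s.

Definition level (n k : nat) : bool := 2 <= k <= n.

(* A sequence (g_2, ..., g_n) is given by g : nat -> 'S_n; values of g outside
   the levels are never used, in particular g_1 is 1 whatever the value of g 1. *)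
Definition tower_elt (n : nat) (g : nat -> 'S_n) (k : nat) : 'S_n :=
  if k == 1 then 1%g else g k.

Definition quot (n : nat) (g : nat -> 'S_n) (k : nat) : 'S_n :=
  pcomp (tower_elt g k.-1)^-1%g (tower_elt g k).

Definition tower (n : nat) (g : nat -> 'S_n) : Prop :=
  forall k, level n k ->
    g k \in symG n k :\: symG n k.-1 /\ kcycle k (quot g k).

(* M_k.+1 = (M_k g_k.+1)^k M_k; for k = 0 this gives M_1 = [::]. *)
Fixpoint Mword (n : nat) (g : nat -> 'S_n) (k : nat) : seq 'S_n :=
  if k is k'.+1 then
    flatten (nseq k' (rcons (Mword g k') (g k))) ++ Mword g k'
  else [::].

Definition cycle_word (n : nat) (g : nat -> 'S_n) : seq 'S_n :=
  rcons (Mword g n) (g n).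

(* The vertex at position i is w_1 ... w_i. *)
Definition vertex (n : nat) (g : nat -> 'S_n) (i : nat) : 'S_n :=
  foldl (@pcomp n) 1%g (take i (cycle_word g)).

(* The letter w_(i+1), which has index i in the zero-based sequence; the default
   value 1 is only returned for i >= n!. *)
Definition generator_at (n : nat) (g : nat -> 'S_n) (i : nat) : 'S_n :=
  nth 1%g (cycle_word g) i.

Definition factorial_expansion (n : nat) (c : nat -> nat) (i : nat) : Prop :=
  (forall k, level n k -> c k < k) /\
  i = \sum_(2 <= k < n.+1) c k * (k.-1)`!.

(* u_n^(c_n) u_(n-1)^(c_(n-1)) ... u_2^(c_2), in this order. *)
Definition quot_prod (n : nat) (g : nat -> 'S_n) (c : nat -> nat) : 'S_n :=
  \big[@pcomp n/1%g]_(k <- rev (index_iota 2 n.+1)) (quot g k ^+ c k)%g.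

Definition least_level (n : nat) (P : nat -> Prop) (k : nat) : Prop :=
  [/\ level n k, P k & forall j, level n j -> P j -> k <= j].

Definition largest_level (n : nat) (P : nat -> Prop) (k : nat) : Prop :=
  [/\ level n k, P k & forall j, level n j -> P j -> j <= k].

(* Main.v *)
Require Import Defs.
From mathcomp Require Import all_boot all_fingroup.

(** Write [B] for the block [M_(k-1) g_k], of length [(k-1)!].  By construction
    [M_k] is [B] repeated [k-1] times followed by [M_(k-1)], so a position
    [q (k-1)! + r] with [q < k] and [r < (k-1)!] is reached by reading [q] full
    blocks and then the first [r] letters of one more copy of [M_(k-1)]
    ([Mword_split]).  Here [q] is the top factorial-base digit of the position
    and [r] carries the remaining digits, so both claims follow by induction
    on [k].

    Vertices.  The word [M_k] multiplies out to [g_k^-1] ([word_prod_Mword]).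
    Indeed, if [M_(k-1)] multiplies out to [g_(k-1)^-1], then the block [B] has
    product [g_(k-1)^-1 g_k = u_k]; since [M_k g_k] is [B] repeated [k] times and
    [u_k], being a [k]-cycle, satisfies [u_k^k = 1], the product of [M_k g_k] is
    [1].  Hence the [q] full blocks contribute exactly [u_k^q]
    ([word_prod_take_Mword]).

    Letters.  The letter of [M_k] at the position is [g_k] when [r] is the last
    position of its block, that is, when all digits below level [k] are maximal
    and the digit [q] is not; otherwise it is a letter of [M_(k-1)]
    ([nth_Mword]).  The divisibility description
    is a matter of carries: [m!] divides [i+1] exactly when adding one to [i]
    carries out of all levels up to [m], that is, when the digits at these
    levels are all maximal ([dvdn_fact_succ]). *)

(** * Factorial-base digits *)

Definition maximal_digits (m : nat) (c : nat -> nat) : Prop :=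
  forall j, level m j -> c j = j.-1.

Lemma level_succ {m j} : level m j -> level m.+1 j.
Proof. by case/andP=> j2 jm; rewrite /level j2 leqW. Qed.

Lemma level_top {m} : 0 < m -> level m.+1 m.+1.
Proof. by move=> m0; rewrite /level ltnS m0 /=. Qed.

Lemma level_succE {m j} : level m.+1 j -> j = m.+1 \/ level m j.
Proof.
rewrite /level => /andP[j2]; rewrite leq_eqVlt => /orP[/eqP->|]; first by left.
by rewrite ltnS => jm; right; rewrite j2.
Qed.

Lemma factorial_expansion_succ {k c i} :
  0 < k -> factorial_expansion k.+1 c i ->
  exists r, [/\ factorial_expansion k c r, c k.+1 <= k & i = c k.+1 * k`! + r].
Proof.
move=> k0 [hc ->]; exists (\sum_(2 <= j < k.+1) c j * (j.-1)`!); split.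
- by split=> // j /level_succ/hc.
- exact: hc (level_top k0).
- by rewrite big_nat_recr //= addnC.
Qed.

Lemma factorial_expansion1 {c i} : factorial_expansion 1 c i -> i = 0.
Proof. by case=> _ ->; rewrite big_geq. Qed.

Lemma factorial_expansion_lt {k c i} :
  0 < k -> factorial_expansion k c i -> i < k`!.
Proof.
elim: k i => // -[|k] IHk i _; first by move/factorial_expansion1->.
move=> /(factorial_expansion_succ (ltn0Sn k))[r [hr hq ->]].
rewrite [ltnRHS]factS mulSn addnC -addSn.
by rewrite leq_add ?leq_mul2r ?hq ?orbT //; apply: IHk hr.
Qed.

(** A mixed-radix analogue of 99...9 + 1 = 100...0. *)
Lemma succ_eq_fact {k c i} :
  0 < k -> factorial_expansion k c i -> (i.+1 = k`! <-> maximal_digits k c).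
Proof.
elim: k i => // -[|k] IHk i _.
  move/factorial_expansion1->; split=> // _ j /andP[j2 j1].
  by have := leq_trans j2 j1.
move=> /(factorial_expansion_succ (ltn0Sn k))[r [hr hq ->]].
have hlt := factorial_expansion_lt (ltn0Sn k) hr.
have IH := IHk r (ltn0Sn k) hr.
split=> [|hmax]; last first.
  rewrite (hmax _ (level_top (ltn0Sn k))) -addnS /=.
  have -> : r.+1 = k.+1`! by apply/IH => j /level_succ/hmax.
  by rewrite [RHS]factS mulSn addnC.
rewrite [RHS]factS mulSn -addnS => e.
have hqE : c k.+2 = k.+1.
  apply/eqP; rewrite eqn_leq hq /= -(leq_pmul2r (fact_gt0 k.+1)).
  by rewrite -(leq_add2l (k.+1)`!) -e addnC leq_add2r.
move=> j /level_succE[->//|]; move: j; apply/IH.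
by apply/eqP; rewrite -(eqn_add2r (k.+1 * (k.+1)`!)) -e hqE addnC.
Qed.

Lemma fact_dvdn_fact {m n} : m <= n -> m`! %| n`!.
Proof. by move=> mn; rewrite -(bin_fact mn) dvdn_mull // dvdn_mulr. Qed.

(** The levels above [m] contribute a multiple of [m!], so only the digits up to
    [m] matter; they represent a number smaller than [m!], whose successor is
    divisible by [m!] only if it equals [m!]. *)
Lemma dvdn_fact_succ {n m c i} :
  0 < m <= n -> factorial_expansion n c i ->
  (m`! %| i.+1 <-> maximal_digits m c).
Proof.
case/andP=> m0; elim: n i => [|n IHn] i; first by rewrite leqNgt m0.
rewrite leq_eqVlt => /orP[/eqP-> hi|].
  have succE := succ_eq_fact (ltn0Sn n) hi.
  split=> [/(dvdn_leq (ltn0Sn i)) le | /succE->//]; apply/succE.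
  by apply/eqP; rewrite eqn_leq le (factorial_expansion_lt _ hi).
rewrite ltnS => mn /(factorial_expansion_succ (leq_trans m0 mn))[r [hr _ ->]].
by rewrite -addnS dvdn_addr ?dvdn_mull ?fact_dvdn_fact //; apply: IHn.
Qed.

(** Both sides pick the level at which the carries of [i + 1] stop. *)
Lemma least_nonmaximal_digitE {n c i k} :
  0 < n -> factorial_expansion n c i -> i.+1 < n`! ->
  least_level n (fun k => c k < k.-1) k <->
  largest_level n (fun k => (k.-1)`! %| i.+1) k.
Proof.
move=> n0 hi ilt.
have pred_level j : level n j -> 0 < j.-1 <= n.
  by case/andP; case: j => [|[|j]] //= _ /ltnW.
split=> -[hk Pk kP]; have /andP[k2 kn] := hk; split=> //.
- apply/(dvdn_fact_succ (pred_level _ hk) hi) => j /andP[j2 jk].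
  have {}jk : j < k by case: (k) k2 jk.
  have hj : level n j by rewrite /level j2 (leq_trans (ltnW jk)).
  apply/eqP; rewrite eqn_leq; apply/andP; split.
    by have := hi.1 _ hj; case: (j) j2.
  by rewrite leqNgt; apply/negP => /(kP _ hj); rewrite leqNgt jk.
- move=> j hj /(dvdn_fact_succ (pred_level _ hj) hi) hmax.
  rewrite leqNgt; apply/negP => kj.
  have hkj : level j.-1 k by rewrite /level k2; case: (j) kj.
  by move: Pk; rewrite (hmax _ hkj) ltnn.
- have hck : c k <= k.-1 by have := hi.1 _ hk; case: (k) k2.
  rewrite ltn_neqAle hck andbT; apply/eqP => ek.
  have k0 : 0 < k by apply: leq_trans k2.
  have hmax : maximal_digits k c.
    move=> j; rewrite -(prednK k0) => /level_succE[->|].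
      by rewrite prednK.
    by move: j; apply/(dvdn_fact_succ (pred_level _ hk) hi).
  have dk : k`! %| i.+1 by apply/(dvdn_fact_succ _ hi); rewrite ?k0.
  case: (ltngtP k n) kn => // [kn _ | ekn _].
    have hk1 : level n k.+1 by rewrite /level kn ltnS k0.
    by have := kP _ hk1 dk; rewrite ltnn.
  by move: dk => /(dvdn_leq (ltn0Sn i)); rewrite ekn leqNgt ilt.
- move=> j hj Pj; rewrite leqNgt; apply/negP => jk.
  have hjk : level k.-1 j.
    by case/andP: hj => j2 _; rewrite /level j2; case: (k) jk.
  move/(dvdn_fact_succ (pred_level _ hk) hi): Pk => /(_ _ hjk) ej.
  by move: Pj; rewrite ej ltnn.
Qed.

(** * Cycles and products of words *)

Lemma single_cycle_expg {n k} {s : 'S_n} : single_cycle k s -> (s ^+ k = 1)%g.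
Proof.
case/existsP=> x /andP[/eqP <- on_s]; apply/permP => y; rewrite perm1.
have [|y_out] := boolP (y \in porbit s x).
  (* [s ^+ k] fixes [x] and commutes with [s], hence fixes the orbit of [x]. *)
  case/porbitP=> j ->; rewrite -permM -expgD addnC expgD permM.
  by congr (_ _); rewrite permX iter_porbit.
by rewrite permX; elim: #|_| => //= m ->; apply: (out_perm on_s).
Qed.

Definition word_prod {n : nat} (w : seq 'S_n) : 'S_n :=
  foldl (@Defs.pcomp n) 1%g w.

(** The factors are swapped on the right because [Defs.pcomp p q] is [q * p]. *)
Lemma word_prod_cat {n} (v w : seq 'S_n) :
  word_prod (v ++ w) = (word_prod w * word_prod v)%g.
Proof.
elim/last_ind: w => [|w x IHw]; first by rewrite cats0 mul1g.
by rewrite -rcons_cat /word_prod !foldl_rcons /Defs.pcomp -mulgA -IHw.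
Qed.

Lemma word_prod_rcons {n} (w : seq 'S_n) x :
  word_prod (rcons w x) = (x * word_prod w)%g.
Proof. by rewrite /word_prod foldl_rcons. Qed.

Lemma word_prod_nseq {n} (w : seq 'S_n) q :
  word_prod (flatten (nseq q w)) = (word_prod w ^+ q)%g.
Proof. by elim: q => //= q IHq; rewrite word_prod_cat IHq expgSr. Qed.

(** * The words of the tower *)

Section Words.

Variables (n : nat) (g : nat -> 'S_n).

Definition block (k : nat) : seq 'S_n := rcons (Mword g k) (g k.+1).

Lemma MwordS k : Mword g k.+1 = flatten (nseq k (block k)) ++ Mword g k.
Proof. by []. Qed.

Lemma size_block k : size (block k) = k`!.
Proof.
elim: k => // k IHk; rewrite /block size_rcons MwordS size_cat.
rewrite size_flatten /shape map_nseq sumn_nseq IHk -addnS factS mulSn addnC.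
by rewrite mulnC -IHk size_rcons.
Qed.

Lemma size_nseq_block k q : size (flatten (nseq q (block k))) = q * k`!.
Proof. by rewrite size_flatten /shape map_nseq sumn_nseq size_block mulnC. Qed.

Lemma size_Mword k : (size (Mword g k)).+1 = k`!.
Proof. by rewrite -size_block size_rcons. Qed.

(** For [q = k] the last copy of [M_k] ends the word, so that no letter
    [g_(k+1)] follows it. *)
Lemma Mword_split {k q} : q <= k ->
  Mword g k.+1 = flatten (nseq q (block k)) ++ Mword g k ++
    (if q < k then g k.+1 :: flatten (nseq (k - q.+1) (block k)) ++ Mword g k
     else [::]).
Proof.
rewrite leq_eqVlt => /orP[/eqP->|qk]; first by rewrite ltnn cats0.
rewrite qk MwordS -{1}(subnKC qk) addSnnS nseqD flatten_cat -catA /=.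
by rewrite -!catA -cat_rcons.
Qed.

(** The bound on [r] keeps the prefix inside the last copy of [M_k]. *)
Lemma take_Mword {k q r} : q <= k -> r < k`! ->
  take (q * k`! + r) (Mword g k.+1) =
  flatten (nseq q (block k)) ++ take r (Mword g k).
Proof.
move=> qk rk; rewrite (Mword_split qk) take_cat size_nseq_block.
rewrite ltnNge leq_addr /= addKn.
by rewrite takel_cat // -ltnS size_Mword.
Qed.

Lemma nth_Mword {k c i} : 0 < k -> factorial_expansion k c i -> i.+1 < k`! ->
  exists m, least_level k (fun k => c k < k.-1) m /\
            nth 1%g (Mword g k) i = g m.
Proof.
elim: k i => // -[|k] IHk i _; first by move=> /factorial_expansion1->.
move=> hi ilt; have k0 := ltn0Sn k.
have [r [hr hq ei]] := factorial_expansion_succ k0 hi.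
have := factorial_expansion_lt k0 hr.
have -> : nth 1%g (Mword g k.+2) i =
    nth 1%g (Mword g k.+1 ++
      (if c k.+2 < k.+1
       then g k.+2 :: flatten (nseq (k.+1 - (c k.+2).+1) (block k.+1))
              ++ Mword g k.+1 else [::])) r.
  rewrite (Mword_split hq) nth_cat size_nseq_block ei.
  by rewrite ltnNge leq_addr addKn.
rewrite nth_cat leq_eqVlt => /orP[/eqP er | rlt]; last first.
  rewrite -ltnS size_Mword rlt.
  have [m [[hm Pm mP] ->]] := IHk _ k0 hr rlt.
  exists m; split=> //; split=> // [|j]; first exact: level_succ.
  by case/level_succE=> [->|hj] Pj; [case/andP: hm => _ /leqW | apply: mP].
(* Here [r] is the length of [M_(k+1)], so the digits below the top one are
   maximal, and [i + 1 < (k+2)!] forces the top digit not to be. *)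
move/(succ_eq_fact k0 hr): (er) => hmax.
have qlt : c k.+2 < k.+1.
  rewrite ltn_neqAle hq andbT; apply/eqP => eq.
  suff : i.+1 = k.+2`! by move=> e; rewrite e ltnn in ilt.
  by rewrite ei eq -addnS er [RHS]factS mulSn addnC.
have -> : r = size (Mword g k.+1) by apply/eqP; rewrite -eqSS size_Mword er.
rewrite ltnn subnn qlt; exists k.+2; split=> //; split=> // [|j].
  exact: level_top.
by case/level_succE=> [->//|hj]; rewrite (hmax _ hj) ltnn.
Qed.

Hypothesis g_tower : tower g.

Lemma quot_expg k : level n k -> (quot g k ^+ k = 1)%g.
Proof. by move=> /g_tower[_ /andP[_ /single_cycle_expg]]. Qed.

Lemma word_prod_block k : 0 < k ->
  word_prod (Mword g k) = (tower_elt g k)^-1%g ->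
  word_prod (block k) = quot g k.+1.
Proof.
by case: k => // k _ e; rewrite word_prod_rcons e /quot /Defs.pcomp /tower_elt.
Qed.

(** With [u_k ^ k = 1], the [k-1] blocks at the front of [M_k] multiply out to
    [u_k^-1 = g_k^-1 g_(k-1)], and the final [M_(k-1)] cancels [g_(k-1)]. *)
Lemma word_prod_Mword k :
  0 < k <= n -> word_prod (Mword g k) = (tower_elt g k)^-1%g.
Proof.
elim: k => // -[|k] IHk /andP[_ kn]; first by rewrite /= invg1.
have {IHk} IH := IHk (ltnW kn).
rewrite MwordS word_prod_cat word_prod_nseq (word_prod_block _ _ IH) // IH.
have hu : (quot g k.+2 ^+ k.+1 = (quot g k.+2)^-1)%g.
  by apply/eqP; rewrite eq_sym eq_invg_mul -expgS quot_expg.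
by rewrite hu /quot /Defs.pcomp invMg invgK mulKg.
Qed.

Lemma word_prod_take_Mword {k c i} :
  0 < k <= n -> factorial_expansion k c i ->
  word_prod (take i (Mword g k)) =
  \big[@Defs.pcomp n/1%g]_(j <- rev (index_iota 2 k.+1)) (quot g j ^+ c j)%g.
Proof.
elim: k i => // -[|k] IHk i /andP[_ kn]; first by rewrite big_nil.
move=> /(factorial_expansion_succ (ltn0Sn k))[r [hr hq ->]].
rewrite take_Mword ?(factorial_expansion_lt _ hr) // word_prod_cat.
have k_le : 0 < k.+1 <= n := ltnW kn.
rewrite word_prod_nseq (word_prod_block _ _ (word_prod_Mword _ k_le)) // IHk //.
have -> : index_iota 2 k.+3 = rcons (index_iota 2 k.+2) k.+2.
  by rewrite /index_iota !subSS !subn0 -[in LHS](addn1 k) iotaD -cats1.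
by rewrite rev_rcons big_cons.
Qed.

End Words.

(* At the last position i = n! - 1 every digit is maximal, so there is no least
   level with c_k < k - 1; there the generator g_n is given by the divisibility
   description alone. *)
Theorem proposition4p1 (n : nat) (hn : 2 <= n) (g : nat -> 'S_n)
    (hg : tower g) (i : nat) (hi : i < n`!) (c : nat -> nat)
    (hc : factorial_expansion n c i) :
  [/\ vertex g i = quot_prod g c,
      i.+1 < n`! ->
        exists k, least_level n (fun k => c k < k.-1) k /\
                  generator_at g i = g k,
      exists k, largest_level n (fun k => (k.-1)`! %| i.+1) k /\
                generator_at g i = g k
    & i.+1 < n`! ->
        forall k, least_level n (fun k => c k < k.-1) k <->
                  largest_level n (fun k => (k.-1)`! %| i.+1) k].
Proof.
have n0 : 0 < n by apply: leq_trans hn.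
have least : i.+1 < n`! ->
    exists k, least_level n (fun k => c k < k.-1) k /\ generator_at g i = g k.
  move=> ilt; have [m [hm em]] := nth_Mword n g n0 hc ilt.
  exists m; split=> //; rewrite /generator_at /cycle_word nth_rcons.
  by rewrite -ltnS size_Mword ilt.
split=> //.
- rewrite /vertex /cycle_word -cats1 takel_cat; last by rewrite -ltnS size_Mword.
  by apply: (word_prod_take_Mword n g hg _ hc); rewrite n0 leqnn.
- move: hi; rewrite leq_eqVlt => /orP[/eqP ei | ilt].
    exists n; split; last first.
      rewrite /generator_at /cycle_word nth_rcons.
      have -> : i = size (Mword g n) by apply/eqP; rewrite -eqSS size_Mword ei.
      by rewrite ltnn eqxx.
    split; first by rewrite /level hn /=.
      by rewrite ei fact_dvdn_fact ?leq_pred.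
    by move=> j /andP[].
  have [k [hk ek]] := least ilt.
  by exists k; split=> //; apply/(least_nonmaximal_digitE n0 hc ilt).
- by move=> ilt k; apply: least_nonmaximal_digitE.
Qed.
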